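(* Let $\mathcal K$ be a category of posets, each object $\mathcal C$ of which is equipped with a subcanonical Grothendieck topology $J_{\mathcal C}$, such that the morphisms $\mathcal C\to\mathcal D$ of $\mathcal K$ are exactly the morphisms of sites $(\mathcal C,J_{\mathcal C})\to(\mathcal D,J_{\mathcal D})$. Suppose that for every $\mathcal C$ in $\mathcal K$ the theory of $J_{\mathcal C}$-prime filters on $\mathcal C$ is coherent. Let $A:\mathcal K^{\mathrm{op}}\to\mathbf{Top}$ be the functor sending $\mathcal C$ to the space $X_{\mathcal C}$ of points of the topos $\mathbf{Sh}(\mathcal C,J_{\mathcal C})$, and let $A_p(\mathcal C)$ be the set $X_{\mathcal C}$ equipped with the $\mathcal C$-patch topology (where $\mathcal C$ is regarded as a subset of $\mathscr P(X_{\mathcal C})$) and with the specialization preorder of the space $A(\mathcal C)$; for an arrow $f$ of $\mathcal K$ let $A_p(f)$ have the same underlying function as $A(f)$. Then: (1) $A_p$ is a functor $\mathcal K^{\mathrm{op}}\to\mathbf{PTop}$ and $r_P\circ A_p\cong A$. (2) If $A$ is part of an equivalence of categories with its extended image, then $A_p$ is also part of an equivalence of categories with its extended image. (3) Suppose in addition that for every $\mathcal C$ in $\mathcal K$ there is a class $\mathcal M_{\mathcal C}$ of maps from $\mathcal C$ to Boolean algebras such that: (a) if the composite of a function $g$ from $\mathcal C$ to a Boolean algebra with each member of some jointly injective family of Boolean algebra homomorphisms belongs to $\mathcal M_{\mathcal C}$, then $g$ belongs to $\mathcal M_{\mathcal C}$; (b) the maps $\mathcal C\to\{0,1\}$ in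 $\mathcal M_{\mathcal C}$ are exactly the flat $J_{\mathcal C}$-continuous functors $\mathcal C\to\{0,1\}$; (c) the free $(\mathbf{Bool},\mathcal M_{\mathcal C})$-structure on $\mathcal C$ exists. Then all the preordered topological spaces in the image of $A_p$ are Priestley spaces.
   Context: Theory of $J$-prime filters on a poset $\mathcal C$ with Grothendieck topology $J$: the propositional geometric theory with one atomic proposition $F_a$ for each $a\in\mathcal C$ and axioms $\top\vdash\bigvee_{c\in\mathcal C}F_c$; $F_a\vdash F_b$ for $a\le b$; $F_a\wedge F_b\vdash\bigvee_{c\le a,\,c\le b}F_c$; and $F_a\vdash\bigvee_{i}F_{a_i}$ for each $J$-covering sieve $\{a_i\to a\}$. It is coherent if it is equivalent in geometric logic to a coherent (finitary) theory over the same signature. Its $\mathbf{Set}$-models are the points of $\mathbf{Sh}(\mathcal C,J)$, i.e. the flat $J$-continuous functors $\mathcal C\to\{0,1\}$. The space of points $X_{\mathcal C}$ carries the topology whose open sets correspond to the subterminal objects of the topos; its frame of opens is isomorphic to the frame $Id_{J_{\mathcal C}}(\mathcal C)$ of $J_{\mathcal C}$-ideals on $\mathcal C$, and $\mathcal C$ is regarded as a subset of $\mathscr P(X_{\mathcal C})$ via $\mathcal C\rightarrowtail Id_{J_{\mathcal C}}(\mathcal C)\cong\mathcal O(X_{\mathcal C})\subseteq\mathscr P(X_{\mathcal C})$. $A$ acts on an arrow by the continuous map of spaces of points induced by the corresponding geometric morphism. For $A\subseteq\mathscr P(X)$, the $A$-patch topology on $X$ has as a subbasis the elements of $A$ and their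 complements. The specialization preorder of a space: $x\le y$ iff every open set containing $x$ contains $y$. $\mathbf{PTop}$: objects are triples $(X,\tau,\le)$ with $\tau$ a topology and $\le$ a preorder on $X$; arrows are continuous order-preserving maps. $r_P:\mathbf{PTop}\to\mathbf{Top}$ sends $(X,\tau,\le)$ to $X$ with the topology of those open sets of $\tau$ that are $\le$-upper sets, and is the identity on underlying functions. The extended image of a functor $F:\mathcal U\to\mathcal V$ is the smallest subcategory of $\mathcal V$ closed under isomorphisms in $\mathcal V$ through which $F$ factors. Free $(\mathbf{Bool},\mathcal M_{\mathcal C})$-structure on $\mathcal C$: a Boolean algebra $L$ with a map $i:\mathcal C\to L$ in $\mathcal M_{\mathcal C}$ such that every map $\mathcal C\to B$ in $\mathcal M_{\mathcal C}$ extends uniquely along $i$ to a Boolean algebra homomorphism $L\to B$. A family of maps out of a common domain is jointly injective if elements on which all the maps agree are equal. A Priestley space is a compact partially ordered topological space such that whenever $x\nleq y$ there is a clopen upper set containing $x$ and not $y$. *)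

(* Defs.v *)
From HB Require Import structures.
From mathcomp Require Import all_boot all_order.
From mathcomp Require Import boolp classical_sets functions cardinality topology.
From Stdlib Require Import RelationClasses.

Set Implicit Arguments.
Unset Strict Implicit.
Unset Printing Implicit Defensive.

Local Open Scope classical_set_scope.

Lemma sig_inj (T : Type) (P : T -> Prop) (u v : {x : T | P x}) :
  sval u = sval v -> u = v.
Proof.
by case: u v => [x Px] [y Py] /= E; subst y; rewrite (Prop_irrelevance Px Py).
Qed.

(** * Categories *)

Record category := Category {
  obj :> Type;
  hom : obj -> obj -> Type;
  idm : forall X, hom X X;
  cmp : forall X Y Z, hom Y Z -> hom X Y -> hom X Z;
  cmp1m : forall X Y (f : hom X Y), cmp (idm Y) f = f;
  cmpm1 : forall X Y (f : hom X Y), cmp f (idm X) = f;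
  cmpA : forall X Y Z W (f : hom Z W) (g : hom Y Z) (h : hom X Y),
    cmp f (cmp g h) = cmp (cmp f g) h }.

Arguments hom {c} _ _.
Arguments idm {c} X.
Arguments cmp {c X Y Z} _ _.

Definition op_cat (C : category) : category :=
  @Category C (fun X Y => hom Y X) (fun X => idm X)
    (fun X Y Z f g => cmp g f)
    (fun X Y f => cmpm1 f) (fun X Y f => cmp1m f)
    (fun X Y Z W f g h => esym (cmpA h g f)).

Definition full_cat (C : category) (K : Type) (o : K -> C) : category :=
  @Category K (fun k l => hom (o k) (o l)) (fun k => idm (o k))
    (fun k l m f g => cmp f g)
    (fun k l f => cmp1m f) (fun k l f => cmpm1 f)
    (fun k l m n f g h => cmpA f g h).

Record is_functor (C D : category) (F : C -> D)
    (Fm : forall X Y, hom X Y -> hom (F X) (F Y)) : Prop := IsFunctor {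
  functor1 : forall X, Fm X X (idm X) = idm (F X);
  functorM : forall X Y Z (f : hom Y Z) (g : hom X Y),
    Fm X Z (cmp f g) = cmp (Fm Y Z f) (Fm X Y g) }.

Record functor (C D : category) := Functor {
  fob :> C -> D;
  fmap : forall X Y, hom X Y -> hom (fob X) (fob Y);
  functorP : is_functor fmap }.

Arguments Functor {C D fob fmap} functorP.
Arguments fmap {C D} f {X Y} _.

Lemma id_functorP (C : category) :
  @is_functor C C (fun X => X) (fun _ _ f => f).
Proof. by []. Qed.

Definition id_functor (C : category) : functor C C := Functor (id_functorP C).

Lemma comp_functorP (C D E : category) (G : functor D E) (F : functor C D) :
  @is_functor C E (fun X => G (F X)) (fun _ _ f => fmap G (fmap F f)).
Proof.
split=> [X|X Y Z f g]; first by rewrite !(functor1 (functorP _)).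
by rewrite !(functorM (functorP _)).
Qed.

Definition comp_functor (C D E : category) (G : functor D E) (F : functor C D)
  : functor C E := Functor (comp_functorP G F).

Definition is_iso (C : category) (X Y : C) (f : hom X Y) : Prop :=
  exists g : hom Y X, cmp g f = idm X /\ cmp f g = idm Y.

Definition naturally_isomorphic (C D : category) (F G : functor C D) : Prop :=
  exists eta : forall X, hom (F X) (G X),
    (forall X, is_iso (eta X)) /\
    (forall X Y (f : hom X Y), cmp (eta Y) (fmap F f) = cmp (fmap G f) (eta X)).

Definition is_equivalence (C D : category) (F : functor C D) : Prop :=
  exists G : functor D C,
    naturally_isomorphic (comp_functor G F) (id_functor C) /\
    naturally_isomorphic (comp_functor F G) (id_functor D).

(** * Subcategories and extended images *)

Record subcategory (V : category) := Subcategory {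
  sub_ob : V -> Prop;
  sub_hom : forall X Y : V, hom X Y -> Prop;
  sub_dom : forall X Y (f : hom X Y), sub_hom f -> sub_ob X;
  sub_cod : forall X Y (f : hom X Y), sub_hom f -> sub_ob Y;
  sub_idm : forall X, sub_ob X -> sub_hom (idm X);
  sub_cmp : forall X Y Z (f : hom Y Z) (g : hom X Y),
    sub_hom f -> sub_hom g -> sub_hom (cmp f g) }.

Arguments sub_hom {V} s {X Y} _.

Definition closed_under_iso (V : category) (S : subcategory V) : Prop :=
  forall (X Y : V) (f : hom X Y), sub_ob S X -> is_iso f -> sub_hom S f.

Definition factors_through (U V : category) (F : functor U V)
    (S : subcategory V) : Prop :=
  (forall X, sub_ob S (F X)) /\
  (forall X Y (f : hom X Y), sub_hom S (fmap F f)).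

Section ExtendedImage.
Variables (U V : category) (F : functor U V).

Let eim_ob (X : V) : Prop := forall S : subcategory V,
  closed_under_iso S -> factors_through F S -> sub_ob S X.
Let eim_hom (X Y : V) (f : hom X Y) : Prop := forall S : subcategory V,
  closed_under_iso S -> factors_through F S -> sub_hom S f.

Let eim_dom X Y (f : hom X Y) : eim_hom f -> eim_ob X.
Proof. by move=> Hf S iS FS; apply: sub_dom (Hf S iS FS). Qed.

Let eim_cod X Y (f : hom X Y) : eim_hom f -> eim_ob Y.
Proof. by move=> Hf S iS FS; apply: sub_cod (Hf S iS FS). Qed.

Let eim_idm X : eim_ob X -> eim_hom (idm X).
Proof. by move=> HX S iS FS; apply: sub_idm (HX S iS FS). Qed.

Let eim_cmp X Y Z (f : hom Y Z) (g : hom X Y) :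
  eim_hom f -> eim_hom g -> eim_hom (cmp f g).
Proof.
by move=> Hf Hg S iS FS; apply: sub_cmp; [apply: Hf|apply: Hg].
Qed.

Definition extended_image : subcategory V :=
  Subcategory eim_dom eim_cod eim_idm eim_cmp.

Lemma factors_extended_image : factors_through F extended_image.
Proof. by split=> [X|X Y f] S iS [FS FmS]. Qed.

End ExtendedImage.

Section SubCat.
Variables (V : category) (S : subcategory V).

Let sc_ob := {X : V | sub_ob S X}.
Let sc_hom (X Y : sc_ob) := {f : hom (sval X) (sval Y) | sub_hom S f}.
Let sc_idm (X : sc_ob) : sc_hom X X := exist _ _ (sub_idm (svalP X)).
Let sc_cmp (X Y Z : sc_ob) (f : sc_hom Y Z) (g : sc_hom X Y) : sc_hom X Z :=
  exist _ _ (sub_cmp (svalP f) (svalP g)).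

Let sc_cmp1m X Y (f : sc_hom X Y) : sc_cmp (sc_idm Y) f = f.
Proof. by apply: sig_inj; rewrite /= cmp1m. Qed.

Let sc_cmpm1 X Y (f : sc_hom X Y) : sc_cmp f (sc_idm X) = f.
Proof. by apply: sig_inj; rewrite /= cmpm1. Qed.

Let sc_cmpA X Y Z W (f : sc_hom Z W) (g : sc_hom Y Z) (h : sc_hom X Y) :
  sc_cmp f (sc_cmp g h) = sc_cmp (sc_cmp f g) h.
Proof. by apply: sig_inj; rewrite /= cmpA. Qed.

Definition sub_cat : category := Category sc_cmp1m sc_cmpm1 sc_cmpA.

Variables (U : category) (F : functor U V) (FS : factors_through F S).

Let cr_ob (X : U) : sub_cat := exist _ (F X) (FS.1 X).
Let cr_map (X Y : U) (f : hom X Y) : @hom sub_cat (cr_ob X) (cr_ob Y) :=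
  exist _ (fmap F f) (FS.2 _ _ f).

Let cr_functorP : is_functor cr_map.
Proof.
split=> [X|X Y Z f g]; apply: sig_inj => /=.
  by rewrite (functor1 (functorP F)).
by rewrite (functorM (functorP F)).
Qed.

Definition corestriction : functor U sub_cat := Functor cr_functorP.

End SubCat.

Definition equivalence_with_extended_image (U V : category) (F : functor U V)
    : Prop :=
  is_equivalence (corestriction (factors_extended_image F)).

(** * Posets with a Grothendieck topology *)

Section Sieves.
Variables (d : Order.disp_t) (C : porderType d).
Implicit Types (a b : C) (S R : set C).

Definition principal a : set C := [set b | (b <= a)%O].

Definition sieve a S : Prop :=
  S `<=` principal a /\ (forall b c, (c <= b)%O -> S b -> S c).

(* the pullback of a sieve S along b <= a is S `&` principal b *)
Record is_topology (J : C -> set (set C)) : Prop := IsTopology {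
  top_sieve : forall a S, J a S -> sieve a S;
  top_max : forall a, J a (principal a);
  top_stable : forall a b S, J a S -> (b <= a)%O -> J b (S `&` principal b);
  top_trans : forall a S R, J a S -> sieve a R ->
    (forall b, S b -> J b (R `&` principal b)) -> J a R }.

End Sieves.

Record posite := Posite {
  posite_disp : Order.disp_t;
  posite_sort :> porderType posite_disp;
  cov : posite_sort -> set (set posite_sort);
  cov_topology : is_topology cov }.

Arguments cov {p} _.

(* The sheaf condition for the representables Hom(-, c): a matching family for
   Hom(-, c) on a sieve S exists, and is then unique, exactly when every element
   of S lies below c. *)
Definition subcanonical (C : posite) : Prop :=
  forall (c a : C) (S : set C), cov a S ->
    (forall b, S b -> (b <= c)%O) -> (a <= c)%O.

(* Cover-preserving and covering-flat monotone maps; on posets the condition of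
   covering-flatness on parallel pairs of arrows is vacuous. *)
Record is_site_morphism (C D : posite) (f : C -> D) : Prop := IsSiteMorphism {
  sm_mono : forall a b : C, (a <= b)%O -> (f a <= f b)%O;
  sm_cover : forall (a : C) (S : set C), cov a S ->
    cov (f a) [set e | exists2 b, S b & (e <= f b)%O];
  sm_flat0 : forall e : D,
    cov e [set e' | (e' <= e)%O /\ exists c, (e' <= f c)%O];
  sm_flat2 : forall (a b : C) (e : D), (e <= f a)%O -> (e <= f b)%O ->
    cov e [set e' | (e' <= e)%O /\
      exists c, [/\ (c <= a)%O, (c <= b)%O & (e' <= f c)%O]] }.

Lemma cov_up (C : posite) (a : C) (S R : set C) :
  cov a S -> sieve a R -> S `<=` R -> cov a R.
Proof.
move=> aS Ra SR; apply: (top_trans (cov_topology C) aS Ra) => b Sb.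
rewrite (_ : R `&` principal b = principal b); first exact: (top_max (cov_topology C)).
by apply/seteqP; split=> [c []//|c cb]; split=> //; apply: Ra.2 cb (SR _ Sb).
Qed.

Lemma id_site_morphism (C : posite) : is_site_morphism (fun a : C => a).
Proof.
have maxP := top_max (cov_topology C).
split=> //.
- move=> a S aS; apply: (cov_up aS); last by move=> b Sb; exists b.
  have [Sa dS] := top_sieve (cov_topology C) aS.
  split=> [e [b Sb /= eb]|b c cb [b' Sb' bb']].
    exact: Order.POrderTheory.le_trans eb (Sa _ Sb).
  by exists b' => //; exact: Order.POrderTheory.le_trans bb'.
- move=> e; apply: (cov_up (maxP e)).
    split=> [x []//|b c cb [be [x bx]]].
    by split; [exact: Order.POrderTheory.le_trans be|
      exists x; exact: Order.POrderTheory.le_trans bx].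
  by move=> x xe; split=> //; exists x.
- move=> a b e ea eb; apply: (cov_up (maxP e)).
    split=> [x []//|x y yx [xe [c [ca cb xc]]]].
    split; first exact: Order.POrderTheory.le_trans xe.
    by exists c; split=> //; exact: Order.POrderTheory.le_trans xc.
  move=> x xe; split=> //; exists x; split=> //;
    exact: Order.POrderTheory.le_trans xe _.
Qed.

Lemma comp_site_morphism (C D E : posite) (g : D -> E) (f : C -> D) :
  is_site_morphism g -> is_site_morphism f ->
  is_site_morphism (fun a => g (f a)).
Proof.
move=> [gm gc g0 g2] [fm fc f0 f2].
have le_tr := @Order.POrderTheory.le_trans.
have TE := cov_topology E.
split.
- by move=> a b /fm /gm.
- move=> a S aS; apply: (cov_up (gc _ _ (fc _ _ aS))).
    split=> [e [b Sb eb]|x y yx [b Sb xb]]; last first.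
      by exists b => //; exact: le_tr yx xb.
    apply: le_tr eb _; apply/gm/fm.
    exact: (top_sieve (cov_topology C) aS).1 Sb.
  by move=> e [y [b Sb yb] ey]; exists b => //; exact: le_tr ey (gm _ _ yb).
- move=> e; apply: (top_trans TE (g0 e)).
    split=> [x []//|x y yx [xe [c xc]]].
    by split; [exact: le_tr yx xe|exists c; exact: le_tr yx xc].
  move=> e1 [e1e [y e1y]].
  apply: (cov_up (top_stable TE (gc _ _ (f0 y)) e1y)).
    split=> [x []//|x z zx [[xe [c xc]] xe1]].
    split; last exact: le_tr zx xe1.
    by split; [exact: le_tr zx xe|exists c; exact: le_tr zx xc].
  move=> x [[y' [y'y [c y'c]] xy'] xe1]; split=> //.
  split; first exact: le_tr xe1 e1e.
  by exists c; exact: le_tr xy' (gm _ _ y'c).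
- move=> a b e ea eb; apply: (top_trans TE (g2 _ _ _ ea eb)).
    split=> [x []//|x y yx [xe [c [ca cb xc]]]].
    split; first exact: le_tr yx xe.
    by exists c; split=> //; exact: le_tr yx xc.
  move=> e1 [e1e [y [ya yb e1y]]].
  apply: (cov_up (top_stable TE (gc _ _ (f2 _ _ _ ya yb)) e1y)).
    split=> [x []//|x z zx [[xe [c [ca cb xc]]] xe1]].
    split; last exact: le_tr zx xe1.
    split; first exact: le_tr zx xe.
    by exists c; split=> //; exact: le_tr zx xc.
  move=> x [[y' [y'y [c [ca cb y'c]]] xy'] xe1]; split=> //.
  split; first exact: le_tr xe1 e1e.
  by exists c; split=> //; exact: le_tr xy' (gm _ _ y'c).
Qed.

Section PositeCat.

Let shom (C D : posite) := {f : C -> D | is_site_morphism f}.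
Let sidm (C : posite) : shom C C := exist _ _ (id_site_morphism C).
Let scmp (C D E : posite) (g : shom D E) (f : shom C D) : shom C E :=
  exist _ _ (comp_site_morphism (svalP g) (svalP f)).

Let scmp1m C D (f : shom C D) : scmp (sidm D) f = f.
Proof. exact: sig_inj. Qed.
Let scmpm1 C D (f : shom C D) : scmp f (sidm C) = f.
Proof. exact: sig_inj. Qed.
Let scmpA C D E F (f : shom E F) (g : shom D E) (h : shom C D) :
  scmp f (scmp g h) = scmp (scmp f g) h.
Proof. exact: sig_inj. Qed.

Definition Posites : category := Category scmp1m scmpm1 scmpA.

End PositeCat.

(** * Propositional geometric logic *)

Inductive gform (S : Type) : Type :=
| GAtom of S
| GTrue
| GAnd of gform S & gform S
| GOr (I : Type) of I -> gform S.

Arguments GTrue {S}.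

(* a theory is a set of sequents *)
Definition gtheory (S : Type) := gform S -> gform S -> Prop.

Inductive proves (S : Type) (T : gtheory S) : gform S -> gform S -> Prop :=
| proves_axiom p q : T p q -> proves T p q
| proves_id p : proves T p p
| proves_cut p q r : proves T p q -> proves T q r -> proves T p r
| proves_true p : proves T p GTrue
| proves_andl p q : proves T (GAnd p q) p
| proves_andr p q : proves T (GAnd p q) q
| proves_and p q r : proves T p q -> proves T p r -> proves T p (GAnd q r)
| proves_in (I : Type) (q : I -> gform S) i : proves T (q i) (GOr q)
| proves_or (I : Type) (q : I -> gform S) r :
    (forall i, proves T (q i) r) -> proves T (GOr q) r
| proves_dist (I : Type) p (q : I -> gform S) :
    proves T (GAnd p (GOr q)) (GOr (fun i => GAnd p (q i))).

Definition equivalent_theories (S : Type) (T T' : gtheory S) : Prop :=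
  forall p q, proves T p q <-> proves T' p q.

Fixpoint coherent_formula (S : Type) (p : gform S) : Prop :=
  match p with
  | GAtom _ => True
  | GTrue => True
  | GAnd p q => coherent_formula p /\ coherent_formula q
  | GOr T q => finite_set [set: T] /\ forall i, coherent_formula (q i)
  end.

Definition coherent_axioms (S : Type) (T : gtheory S) : Prop :=
  forall p q, T p q -> coherent_formula p /\ coherent_formula q.

Definition is_coherent (S : Type) (T : gtheory S) : Prop :=
  exists T' : gtheory S, coherent_axioms T' /\ equivalent_theories T T'.

Inductive prime_filter_theory (C : posite) : gtheory C :=
| pf_inhabited : prime_filter_theory GTrue (GOr (fun c : C => GAtom c))
| pf_mono (a b : C) : (a <= b)%O -> prime_filter_theory (GAtom a) (GAtom b)
| pf_filter (a b : C) : prime_filter_theory (GAnd (GAtom a) (GAtom b))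
    (GOr (fun c : {c : C | (c <= a)%O /\ (c <= b)%O} => GAtom (sval c)))
| pf_cover (a : C) (S : set C) : cov a S -> prime_filter_theory (GAtom a)
    (GOr (fun c : {c : C | S c} => GAtom (sval c))).

(** * The space of points *)

Section Points.
Variable C : posite.

Record is_flat_continuous (x : C -> bool) : Prop := IsFlatContinuous {
  fc_mono : forall a b, (a <= b)%O -> x a -> x b;
  fc_flat0 : exists a, x a;
  fc_flat2 : forall a b, x a -> x b ->
    exists c, [/\ (c <= a)%O, (c <= b)%O & x c];
  fc_cont : forall a (S : set C), cov a S -> x a -> exists2 b, S b & x b }.

Definition points : Type := {x : C -> bool | is_flat_continuous x}.

HB.instance Definition _ := gen_eqMixin points.
HB.instance Definition _ := gen_choiceMixin points.

(* the subterminal objects of Sh(C, J) *)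
Record is_ideal (I : set C) : Prop := IsIdeal {
  ideal_down : forall a b, (b <= a)%O -> I a -> I b;
  ideal_cov : forall a (S : set C), cov a S -> S `<=` I -> I a }.

Lemma ideal_principal : subcanonical C -> forall c : C, is_ideal (principal c).
Proof.
move=> sC c; split=> [a b ba ac|a S aS Sc]; last exact: sC aS Sc.
exact: Order.POrderTheory.le_trans ba ac.
Qed.

(* the points lying in the subterminal object I *)
Definition ideal_open (I : set C) : set points :=
  [set x : points | exists2 a, I a & sval x a].

Definition points_open : set (set points) :=
  [set U | exists2 I, is_ideal I & U = ideal_open I].

Lemma points_openT : points_open setT.
Proof.
exists setT; first by [].
apply/seteqP; split=> // x _.
by have [a xa] := fc_flat0 (svalP x); exists a.
Qed.

Lemma points_openI : setI_closed points_open.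
Proof.
move=> _ _ [I [Id Ic] ->] [I' [Id' Ic'] ->]; exists (I `&` I').
  split=> [a b ba [/Id Ib /Id' Ib']|a S aS SI]; first by split; eauto.
  by split; [apply: Ic aS _|apply: Ic' aS _] => b /SI[].
apply/seteqP; split=> x [].
  move=> [a Ia xa] [b Ib xb].
  have [c [ca cb xc]] := fc_flat2 (svalP x) xa xb.
  by exists c => //; split; [exact: Id Ia|exact: Id' Ib].
by move=> a [Ia Ia'] xa; split; exists a.
Qed.

Lemma points_open_bigU (T : Type) (f : T -> set points) :
  (forall t, points_open (f t)) -> points_open (\bigcup_t f t).
Proof.
move=> fo; pose D := [set a : C | exists I, [/\ is_ideal I,
  exists t, f t = ideal_open I & I a]].
exists [set a | forall I, is_ideal I -> D `<=` I -> I a].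
  split=> [a b ba Ha I iI DI|a S aS SH I iI DI].
    by apply: (ideal_down iI) ba _; apply: Ha.
  by apply: (ideal_cov iI) aS _ => b Sb; apply: (SH b Sb).
apply/seteqP; split=> x.
  move=> [t _ ftx]; have [I iI fE] := fo t.
  have [a Ia xa] : ideal_open I x by rewrite -fE.
  by exists a => // I' iI' DI'; apply: DI'; exists I; split=> //; exists t.
move=> [a Ha xa].
pose I := [set b | sval x b -> exists2 c, D c & sval x c].
have iI : is_ideal I.
  split=> [b c cb Ib xc|b S bS SI xb].
    by apply: Ib; exact: (fc_mono (svalP x)) cb xc.
  have [c Sc xc] := fc_cont (svalP x) bS xb.
  exact: SI Sc xc.
have DI : D `<=` I by move=> b Db xb; exists b.
have [b [I' [iI' [t ft] I'b]] xb] := Ha I iI DI xa.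
by exists t => //; rewrite ft; exists b.
Qed.

HB.instance Definition _ := @isOpenTopological.Build points points_open
  points_openT points_openI points_open_bigU.

(* C as a subset of P(X_C), through the principal J-ideals *)
Definition basic_opens : set (set points) :=
  [set U | exists c : C, U = ideal_open (principal c)].

End Points.

Arguments is_flat_continuous {C} x.

(** * The functor A *)

Section TopCat.

Let tcmp (X Y Z : topologicalType) (g : continuousType Y Z)
  (f : continuousType X Y) : continuousType X Z := g \o f.
Let tidm (X : topologicalType) : continuousType X X := @idfun X.

Let tcmp1m (X Y : topologicalType) (f : continuousType X Y) : tcmp (tidm Y) f = f.
Proof. exact/continuousEP. Qed.
Let tcmpm1 (X Y : topologicalType) (f : continuousType X Y) : tcmp f (tidm X) = f.
Proof. exact/continuousEP. Qed.
Let tcmpA (X Y Z W : topologicalType) (f : continuousType Z W) (g : continuousType Y Z)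
  (h : continuousType X Y) : tcmp f (tcmp g h) = tcmp (tcmp f g) h.
Proof. exact/continuousEP. Qed.

Definition Top : category :=
  @Category topologicalType (fun X Y => continuousType X Y)
    tidm tcmp tcmp1m tcmpm1 tcmpA.

End TopCat.

Definition Top_fun (X Y : Top) (f : hom X Y) :
    (X : topologicalType) -> (Y : topologicalType) :=
  (f : continuousType X Y).

Section PointsMap.
Variables (C D : posite) (f : {f : C -> D | is_site_morphism f}).

Lemma flat_continuous_comp (x : points D) :
  is_flat_continuous (fun a => sval x (sval f a)).
Proof.
have [fm fc f0 f2] := svalP f; have [xm x0 x2 xc] := svalP x; split.
- by move=> a b /fm; exact: xm.
- have [e xe] := x0.
  have [e' [_ [c e'c]] xe'] := xc _ _ (f0 e) xe.
  by exists c; exact: xm e'c xe'.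
- move=> a b xa xb; have [e [ea eb xe]] := x2 _ _ xa xb.
  have [e' [_ [c [ca cb e'c]]] xe'] := xc _ _ (f2 _ _ _ ea eb) xe.
  by exists c; split=> //; exact: xm e'c xe'.
- move=> a S /fc faS xa; have [e [b Sb eb] xe] := xc _ _ faS xa.
  by exists b => //; exact: xm eb xe.
Qed.

(* The action on points of the geometric morphism Sh(D) -> Sh(C) induced by f
   is precomposition with f. *)
Definition points_map (x : points D) : points C :=
  exist _ _ (flat_continuous_comp x).

Lemma points_map_continuous : continuous points_map.
Proof.
apply/continuousP => _ [I iI ->].
pose I' := [set e : D | exists2 a, I a & (e <= sval f a)%O].
rewrite (_ : _ @^-1` _ =
    \bigcup_(J in [set J | is_ideal J /\ forall x, ideal_open J x ->
       ideal_open I (points_map x)]) ideal_open J).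
  by apply: bigcup_open => J [iJ _]; exists J.
apply/seteqP; split=> [x [a Ia xa]|x [J [_ JI]]]; last exact: JI.
exists [set e | forall J, is_ideal J -> I' `<=` J -> J e]; last first.
  by exists (sval f a) => // J _; apply; exists a.
split.
  split=> [e e' e'e He J iJ IJ|e S eS SH J iJ IJ].
    by apply: (ideal_down iJ) e'e _; exact: He.
  by apply: (ideal_cov iJ) eS _ => b Sb; exact: (SH b Sb).
move=> {xa} {}x [e He xe].
pose J := [set e : D | sval x e -> exists2 a, I a & sval x (sval f a)].
have iJ : is_ideal J.
  split=> [b c cb Ib xc|b S bS SI xb].
    by apply: Ib; exact: (fc_mono (svalP x)) cb xc.
  by have [c Sc] := fc_cont (svalP x) bS xb; exact: SI.
apply: (He J iJ) xe => e' [b Ib e'b] xe'.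
by exists b => //; exact: (fc_mono (svalP x)) e'b xe'.
Qed.

HB.instance Definition _ :=
  isContinuous.Build (points D) (points C) points_map points_map_continuous.

End PointsMap.

Section AFunctor.
Variables (K : Type) (site : K -> Posites).

Let A_ob (k : op_cat (full_cat site)) : Top := points (site k).
Let A_map (k l : op_cat (full_cat site)) (f : hom k l) :
  @hom Top (A_ob k) (A_ob l) := points_map f.

Let A_functorP : is_functor A_map.
Proof.
split=> [k|k l m f g]; apply/continuousEP => x; exact: sig_inj.
Qed.

Definition A_functor : functor (op_cat (full_cat site)) Top :=
  Functor A_functorP.

End AFunctor.

(** * Preordered spaces *)

Record preordered_space := PreorderedSpace {
  ps_space :> topologicalType;
  ps_le : ps_space -> ps_space -> Prop;
  ps_preorder : PreOrder ps_le }.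

Arguments ps_le {p} _ _.

Definition order_preserving (X Y : preordered_space) (f : X -> Y) : Prop :=
  forall x y, ps_le x y -> ps_le (f x) (f y).

Definition upper_set (X : preordered_space) (U : set X) : Prop :=
  forall x y, ps_le x y -> U x -> U y.

Definition priestley_space (X : preordered_space) : Prop :=
  [/\ compact [set: X],
      forall x y : X, ps_le x y -> ps_le y x -> x = y &
      forall x y : X, ~ ps_le x y ->
        exists U : set X, [/\ clopen U, upper_set U, U x & ~ U y]].

Section PTopCat.

Let phom (X Y : preordered_space) :=
  {f : continuousType X Y | order_preserving f}.

Lemma order_preserving_id (X : preordered_space) : order_preserving (@idfun X).
Proof. by []. Qed.

Lemma order_preserving_comp (X Y Z : preordered_space) (g : Y -> Z)
    (f : X -> Y) :
  order_preserving g -> order_preserving f -> order_preserving (g \o f).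
Proof. by move=> gm fm x y /fm /gm. Qed.

Let pidm (X : preordered_space) : phom X X :=
  exist _ (@idfun X : continuousType X X) (@order_preserving_id X).
Let pcmp (X Y Z : preordered_space) (g : phom Y Z) (f : phom X Y) : phom X Z :=
  exist _ (sval g \o sval f : continuousType X Z)
    (order_preserving_comp (svalP g) (svalP f)).

Let pcmp1m X Y (f : phom X Y) : pcmp (pidm Y) f = f.
Proof. by apply: sig_inj; apply/continuousEP. Qed.
Let pcmpm1 X Y (f : phom X Y) : pcmp f (pidm X) = f.
Proof. by apply: sig_inj; apply/continuousEP. Qed.
Let pcmpA X Y Z W (f : phom Z W) (g : phom Y Z) (h : phom X Y) :
  pcmp f (pcmp g h) = pcmp (pcmp f g) h.
Proof. by apply: sig_inj; apply/continuousEP. Qed.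

Definition PTop : category := Category pcmp1m pcmpm1 pcmpA.

End PTopCat.

Definition PTop_fun (X Y : PTop) (f : hom X Y) :
    (X : preordered_space) -> (Y : preordered_space) := sval f.

Section UpperTopology.
Variable X : preordered_space.

Definition upper_space : Type := X.

HB.instance Definition _ := Choice.copy upper_space X.

Definition upper_open : set (set upper_space) :=
  [set U | open (U : set X) /\ upper_set (U : set X)].

Lemma upper_openT : upper_open setT.
Proof. by split=> //; exact: openT. Qed.

Lemma upper_openI : setI_closed upper_open.
Proof.
move=> U V [oU uU] [oV uV]; split; first exact: openI.
by move=> x y xy [/(uU _ _ xy) Uy /(uV _ _ xy) Vy].
Qed.

Lemma upper_open_bigU (I : Type) (f : I -> set upper_space) :
  (forall i, upper_open (f i)) -> upper_open (\bigcup_i f i).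
Proof.
move=> fo; split; first by apply: bigcup_open => i _; exact: (fo i).1.
by move=> x y xy [i _ fx]; exists i => //; exact: (fo i).2 xy fx.
Qed.

HB.instance Definition _ := @isOpenTopological.Build upper_space upper_open
  upper_openT upper_openI upper_open_bigU.

End UpperTopology.

Section RP.

Let rP_ob (X : PTop) : Top := upper_space X.

Definition rP_fun (X Y : PTop) (f : hom X Y) : upper_space X -> upper_space Y :=
  sval f.

Lemma rP_fun_continuous (X Y : PTop) (f : hom X Y) : continuous (rP_fun f).
Proof.
apply/continuousP => U [oU uU]; split.
  by move/continuousP: (@cts_fun _ _ (sval f)); exact.
by move=> x y xy; exact: uU (svalP f _ _ xy).
Qed.

HB.instance Definition _ (X Y : PTop) (f : hom X Y) :=
  isContinuous.Build (upper_space X) (upper_space Y) (rP_fun f)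
    (@rP_fun_continuous X Y f).

Let rP_map (X Y : PTop) (f : hom X Y) : @hom Top (rP_ob X) (rP_ob Y) :=
  rP_fun f.

Let rP_functorP : is_functor rP_map.
Proof. by split=> *; apply/continuousEP. Qed.

Definition rP : functor PTop Top := Functor rP_functorP.

End RP.

Definition specialization (X : topologicalType) (x y : X) : Prop :=
  forall U : set X, open U -> U x -> U y.

Definition patch_subbase (X : Type) (A : set (set X)) : set (set X) :=
  A `|` [set U | A (~` U)].

Definition patch_space (X : choiceType) (A : set (set X)) : Type := X.

HB.instance Definition _ (X : choiceType) (A : set (set X)) :=
  Choice.copy (patch_space A) X.
HB.instance Definition _ (X : choiceType) (A : set (set X)) :=
  isSubBaseTopological.Build (patch_space A) (patch_subbase A) id.

Lemma specialization_preorder (X : topologicalType) :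
  PreOrder (@specialization X).
Proof. by split=> [x U //|x y z xy yz U oU /(xy U oU) /(yz U oU)]. Qed.

Definition Ap_ob (C : posite) : PTop :=
  @PreorderedSpace (patch_space (basic_opens (C := C)))
    (@specialization (points C)) (specialization_preorder (points C)).

(** * Free Boolean algebras *)

(* {tblmorphism B -> B'} does not include preservation of meets and joins. *)
Definition boolean_hom (d d' : Order.disp_t) (B : ctbDistrLatticeType d)
    (B' : ctbDistrLatticeType d') (h : B -> B') : Prop :=
  [/\ {morph h : x y / (x `&` y)%O}, {morph h : x y / (x `|` y)%O},
      {morph h : x / (~` x)%O}, h \bot%O = \bot%O & h \top%O = \top%O].

Definition map_class (C : Type) :=
  forall (d : Order.disp_t) (B : ctbDistrLatticeType d), (C -> B) -> Prop.

Arguments map_class C : clear implicits.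

Definition jointly_injective (T I : Type) (U : I -> Type)
    (h : forall i, T -> U i) : Prop :=
  forall x y, (forall i, h i x = h i y) -> x = y.

Definition reflects_jointly_injective (C : Type) (M : map_class C) : Prop :=
  forall (d : Order.disp_t) (B : ctbDistrLatticeType d) (g : C -> B)
    (I : Type) (dI : I -> Order.disp_t)
    (E : forall i, ctbDistrLatticeType (dI i)) (h : forall i, B -> E i),
    (forall i, boolean_hom (h i)) -> jointly_injective h ->
    (forall i, M (dI i) (E i) (h i \o g)) -> M d B g.

Definition is_free_structure (C : Type) (M : map_class C) (d : Order.disp_t)
    (L : ctbDistrLatticeType d) (i : C -> L) : Prop :=
  M d L i /\
  forall (d' : Order.disp_t) (B : ctbDistrLatticeType d') (g : C -> B),
    M d' B g ->
    exists! h : L -> B, boolean_hom h /\ h \o i = g.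

Definition has_free_structure (C : Type) (M : map_class C) : Prop :=
  exists (d : Order.disp_t) (L : ctbDistrLatticeType d) (i : C -> L),
    is_free_structure M i.

(* Main.v *)
From HB Require Import structures.
From mathcomp Require Import all_boot all_order.
From mathcomp Require Import boolp classical_sets cardinality.
From mathcomp Require Import finmap topology.
Require Import Defs.

Set Implicit Arguments.
Unset Strict Implicit.
Unset Printing Implicit Defensive.

Local Open Scope classical_set_scope.

(** Everything rests on the compactness of the patch topology on the points of
    a site [C] with coherent theory of prime filters. A point is a model of
    that theory, i.e. a valuation of the atoms [c : C], and the patch topology
    is the topology of pointwise convergence of valuations. Take an ultrafilter
    of points and the valuation which makes [c] true when [c] holds at almost
    all of them. Satisfaction of a formula with finite disjunctions passes to
    this limit ([ultralimit_satisfies]), so the limit is a model of a coherent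
    axiomatization of the theory, hence a point ([ultralimit_model],
    [patch_points_compact]).

    The basic opens [{x | x c}] are patch clopen and determine the
    specialization preorder. Together with compactness this makes the patch
    space a Priestley space ([patch_points_priestley]), and it implies that the
    patch open upper sets are exactly the original opens
    ([patch_open_upper_open], [upper_patch_openP]): applying [rP] recovers
    [A], by a natural isomorphism that is the identity on points. A morphism of sites [f] pulls
    the basic open of [c] back to that of [f c], so the induced map of points
    is continuous for the patch topologies as well.

    The statement on extended images is then formal. The functor [rP] is
    faithful and [rP . Ap ~ A], and in this situation an equivalence of [A]
    with its extended image lifts to one of [Ap] with its own
    ([lift_equivalence_with_extended_image]). Indeed [rP] carries the extended
    image of [Ap] into that of [A], where, once [A] is such an equivalence, all
    arrows between objects [A k] come from the source category. *)

(** * Full, faithful and essentially surjective functors *)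

Definition faithful (C D : category) (F : functor C D) : Prop :=
  forall X Y (f g : hom X Y), fmap F f = fmap F g -> f = g.

Definition full (C D : category) (F : functor C D) : Prop :=
  forall X Y (h : hom (F X) (F Y)), exists f, fmap F f = h.

Definition essentially_surjective (C D : category) (F : functor C D) : Prop :=
  forall Y, exists X, exists e : hom (F X) Y, is_iso e.

Lemma iso_monic (C : category) (X Y Z : C) (e : hom Y Z) (f g : hom X Y) :
  is_iso e -> cmp e f = cmp e g -> f = g.
Proof.
by move=> [e' [e'e _]] efg; rewrite -(cmp1m f) -e'e -cmpA efg cmpA e'e cmp1m.
Qed.

Lemma iso_epic (C : category) (X Y Z : C) (e : hom X Y) (f g : hom Y Z) :
  is_iso e -> cmp f e = cmp g e -> f = g.
Proof.
by move=> [e' [_ ee']] efg; rewrite -(cmpm1 f) -ee' cmpA efg -cmpA ee' cmpm1.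
Qed.

Lemma iso_inverse (C : category) (X Y : C) (e : hom X Y) (e' : hom Y X) :
  cmp e' e = idm X -> cmp e e' = idm Y -> is_iso e'.
Proof. by exists e. Qed.

Lemma natural_iso_faithful (C D : category) (F G : functor C D) :
  naturally_isomorphic F G -> faithful G -> faithful F.
Proof.
move=> [eta [eta_iso eta_nat]] Gf X Y f g Ffg.
by apply/Gf/(iso_epic (eta_iso X)); rewrite -!eta_nat Ffg.
Qed.

Lemma comp_faithful (C D E : category) (G : functor D E) (F : functor C D) :
  faithful (comp_functor G F) -> faithful F.
Proof. by move=> GFf X Y f g Ffg; apply: GFf; rewrite /= Ffg. Qed.

Lemma equivalence_faithful (C D : category) (F : functor C D) :
  is_equivalence F -> faithful F.
Proof.
by move=> [G [GF _]]; apply/(@comp_faithful _ _ _ G)/(natural_iso_faithful GF).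
Qed.

(** An arrow [h : F X -> F Y] comes from [eta_Y . G h . eta_X^-1], where [eta]
    is the isomorphism from [G F] to the identity: both have the same image
    under the faithful functor [G]. *)
Lemma equivalence_full (C D : category) (F : functor C D) :
  is_equivalence F -> full F.
Proof.
move=> [G [[eta [eta_iso eta_nat]] FG]] X Y h.
have Gf : faithful G.
  exact/(@comp_faithful _ _ _ F)/(natural_iso_faithful FG).
have [eta'X [eta'K _]] := eta_iso X.
exists (cmp (cmp (eta Y) (fmap G h)) eta'X).
apply/Gf/(iso_monic (eta_iso Y)).
by have /= -> := eta_nat _ _ (cmp (cmp (eta Y) (fmap G h)) eta'X);
  rewrite -cmpA eta'K cmpm1.
Qed.

(** The quasi-inverse chooses a preimage of each object up to isomorphism and
    transports arrows along the chosen isomorphisms. *)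
Lemma fully_faithful_equivalence (C D : category) (F : functor C D) :
  faithful F -> full F -> essentially_surjective F -> is_equivalence F.
Proof.
move=> Ff Fh Fs.
pose pre X Y (h : hom (F X) (F Y)) := sval (cid (Fh X Y h)).
have preK X Y (h : hom (F X) (F Y)) : fmap F (pre X Y h) = h.
  exact: (svalP (cid (Fh X Y h))).
pose g Y := sval (cid (Fs Y)).
pose e Y := sval (cid (svalP (cid (Fs Y)))) : hom (F (g Y)) Y.
have e_iso Y : is_iso (e Y) := svalP (cid (svalP (cid (Fs Y)))).
pose e' Y := sval (cid (e_iso Y)) : hom Y (F (g Y)).
have e'K Y : cmp (e' Y) (e Y) = idm _ := (svalP (cid (e_iso Y))).1.
have eK Y : cmp (e Y) (e' Y) = idm _ := (svalP (cid (e_iso Y))).2.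
pose gm X Y (h : hom X Y) := pre _ _ (cmp (e' Y) (cmp h (e X))).
have gP : is_functor gm.
  split=> [X|X Y Z f h]; apply: Ff.
    by rewrite preK cmp1m e'K (functor1 (functorP F)).
  rewrite (functorM (functorP F)) !preK -!cmpA.
  by rewrite (cmpA (e Y)) eK cmp1m.
exists (Functor gP); split; last first.
  exists e; split=> [Y|X Y f]; first exact: e_iso.
  by rewrite /= preK cmpA eK cmp1m.
exists (fun X => pre (g (F X)) X (e (F X))); split.
  move=> X; exists (pre X (g (F X)) (e' (F X))).
  by split; apply: Ff; rewrite (functorM (functorP F)) !preK ?e'K ?eK
    (functor1 (functorP F)).
move=> X Y f; apply: Ff.
by rewrite /= !(functorM (functorP F)) !preK cmpA eK cmp1m.
Qed.

(** * Functors lifting along a faithful functor *)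

Lemma sub_ob_extended_image (U V : category) (F : functor U V) (X : V) :
  sub_ob (extended_image F) X <-> forall S : subcategory V,
    closed_under_iso S -> factors_through F S -> sub_ob S X.
Proof. exact: iff_refl. Qed.

Lemma sub_hom_extended_image (U V : category) (F : functor U V) (X Y : V)
    (f : hom X Y) :
  sub_hom (extended_image F) f <-> forall S : subcategory V,
    closed_under_iso S -> factors_through F S -> sub_hom S f.
Proof. exact: iff_refl. Qed.

Lemma extended_image_closed_under_iso (U V : category) (F : functor U V) :
  closed_under_iso (extended_image F).
Proof.
move=> X Y f /sub_ob_extended_image HX fi; apply/sub_hom_extended_image.
by move=> S Si FS; apply: (Si _ _ _ _ fi); exact: HX.
Qed.

Lemma sub_cat_iso (V : category) (S : subcategory V) (X Y : sub_cat S)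
    (f : hom X Y) :
  closed_under_iso S -> is_iso (sval f) -> is_iso f.
Proof.
move=> Si [g [gf fg]].
have Sg : sub_hom S g by apply: (Si _ _ g (svalP Y)); exists (sval f).
by exists (exist _ g Sg); split; apply: sig_inj; [exact: gf|exact: fg].
Qed.

Section InverseImage.
Variables (W V : category) (R : functor W V) (S : subcategory V).

Let inv_ob (X : W) := sub_ob S (R X).
Let inv_hom (X Y : W) (f : hom X Y) := sub_hom S (fmap R f).

Let inv_dom X Y (f : hom X Y) : inv_hom f -> inv_ob X.
Proof. exact: sub_dom. Qed.
Let inv_cod X Y (f : hom X Y) : inv_hom f -> inv_ob Y.
Proof. exact: sub_cod. Qed.
Let inv_idm X : inv_ob X -> inv_hom (idm X).
Proof. by rewrite /inv_hom (functor1 (functorP R)); exact: sub_idm. Qed.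
Let inv_cmp X Y Z (f : hom Y Z) (g : hom X Y) :
  inv_hom f -> inv_hom g -> inv_hom (cmp f g).
Proof. by rewrite /inv_hom (functorM (functorP R)); exact: sub_cmp. Qed.

Definition inverse_image_subcategory : subcategory W :=
  Subcategory inv_dom inv_cod inv_idm inv_cmp.

Lemma inverse_image_closed_under_iso :
  closed_under_iso S -> closed_under_iso inverse_image_subcategory.
Proof.
move=> Si X Y f HX [g [gf fg]]; apply: (Si _ _ _ HX); exists (fmap R g).
by rewrite -!(functorM (functorP R)) gf fg !(functor1 (functorP R)).
Qed.

End InverseImage.

Section EssentialImage.
Variables (U W : category) (P : functor U W).

Let ei_ob (Y : W) := exists X, exists e : hom (P X) Y, is_iso e.
Let ei_hom (X Y : W) (_ : hom X Y) := ei_ob X /\ ei_ob Y.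

Let ei_dom X Y (f : hom X Y) : ei_hom f -> ei_ob X. Proof. by case. Qed.
Let ei_cod X Y (f : hom X Y) : ei_hom f -> ei_ob Y. Proof. by case. Qed.
Let ei_idm X : ei_ob X -> ei_hom (idm X). Proof. by []. Qed.
Let ei_cmp X Y Z (f : hom Y Z) (g : hom X Y) :
  ei_hom f -> ei_hom g -> ei_hom (cmp f g).
Proof. by move=> [_ HZ] [HX _]. Qed.

Definition essential_image : subcategory W :=
  Subcategory ei_dom ei_cod ei_idm ei_cmp.

Lemma essential_image_closed_under_iso : closed_under_iso essential_image.
Proof.
move=> X Y f HX [g [gf fg]]; split=> //; have [Z [e [e' [e'e ee']]]] := HX.
exists Z, (cmp f e), (cmp e' g); split.
  by rewrite cmpA -(cmpA e') gf cmpm1.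
by rewrite cmpA -(cmpA f) ee' cmpm1.
Qed.

Lemma factors_essential_image : factors_through P essential_image.
Proof.
have PX X : ei_ob (P X).
  by exists X, (idm (P X)), (idm (P X)); rewrite cmp1m.
by split=> // X Y f; split; exact: PX.
Qed.

(** The essential image, a full subcategory closed under isomorphisms through
    which [P] factors, contains the extended image; and the isomorphisms that
    witness this lie in the extended image. *)
Lemma extended_image_essentially_surjective :
  essentially_surjective (corestriction (factors_extended_image P)).
Proof.
move=> Y; have [X [e ei]] : ei_ob (sval Y).
  have /sub_ob_extended_image := svalP Y.
  move=> /(_ _ essential_image_closed_under_iso); apply.
  exact: factors_essential_image.
have Pe : sub_hom (extended_image P) e.
  apply: (extended_image_closed_under_iso _ ei).
  exact: (factors_extended_image P).1.
by exists X, (exist _ e Pe); apply: sub_cat_iso => //;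
  exact: extended_image_closed_under_iso.
Qed.

End EssentialImage.

Section LiftEquivalence.
Variables (U V W : category) (F : functor U V) (R : functor W V).
Variable P : functor U W.
Hypothesis RPF : naturally_isomorphic (comp_functor R P) F.

(** The inverse image along [R] of the extended image of [F] is closed under
    isomorphisms, and [P] factors through it because [R P f] is conjugate to
    [F f]; so it contains the extended image of [P]. *)
Lemma sub_hom_extended_image_lift (X Y : W) (g : hom X Y) :
  sub_hom (extended_image P) g -> sub_hom (extended_image F) (fmap R g).
Proof.
have [eta [eta_iso eta_nat]] := RPF.
have Fi := @extended_image_closed_under_iso _ _ F.
have [Fob Fhom] := factors_extended_image F.
move=> /sub_hom_extended_image.
move=> /(_ _ (inverse_image_closed_under_iso (R := R) Fi)); apply.
have eta_in X' : sub_hom (extended_image F) (eta X').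
  have [e' [e'K eK]] := eta_iso X'.
  have Fe' : sub_hom (extended_image F) e'.
    exact: Fi (Fob X') (iso_inverse e'K eK).
  exact: Fi (sub_cod Fe') (eta_iso X').
split=> [X'|X' Y' f]; first exact: (sub_dom (eta_in X')).
have [e' [e'K eK]] := eta_iso Y'.
have Fe' : sub_hom (extended_image F) e'.
  exact: Fi (Fob Y') (iso_inverse e'K eK).
have RPf : fmap R (fmap P f) = cmp e' (cmp (fmap F f) (eta X')).
  by rewrite -eta_nat /= cmpA e'K cmp1m.
change (sub_hom (extended_image F) (fmap R (fmap P f))); rewrite RPf.
exact: (sub_cmp Fe' (sub_cmp (Fhom _ _ f) (eta_in X'))).
Qed.

(** Fullness: if [g : P X -> P Y] lies in the extended image of [P], the
    conjugate of [R g] by [R P ~ F] lies in the extended image of [F], hence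
    is some [F f]; then [R g = R P f], and [R] is faithful. *)
Lemma lift_equivalence_with_extended_image :
  faithful R -> equivalence_with_extended_image F ->
  equivalence_with_extended_image P.
Proof.
move=> Rf FE; have [eta [eta_iso eta_nat]] := RPF.
have Fi := @extended_image_closed_under_iso _ _ F.
have Fob := (factors_extended_image F).1.
have Ff : faithful F.
  move=> X Y f g Ffg; apply: (equivalence_faithful FE); exact: sig_inj.
apply: fully_faithful_equivalence.
- move=> X Y f g /(congr1 sval) /= Pfg.
  by apply: (natural_iso_faithful RPF Ff); rewrite /= Pfg.
- move=> X Y [g Pg]; have Rg := sub_hom_extended_image_lift Pg.
  have [e' [e'K eK]] := eta_iso X.
  have h_in : sub_hom (extended_image F) (cmp (cmp (eta Y) (fmap R g)) e').
    apply: sub_cmp; last exact: Fi (Fob X) (iso_inverse e'K eK).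
    by apply: sub_cmp => //; exact: Fi (sub_cod Rg) (eta_iso Y).
  have [f /(congr1 sval) /= Ffh] := equivalence_full FE
    (exist _ _ h_in : @hom (sub_cat (extended_image F))
       (corestriction (factors_extended_image F) X)
       (corestriction (factors_extended_image F) Y)).
  exists f; apply/sig_inj/Rf/(iso_monic (eta_iso Y)) => /=.
  by have /= -> := eta_nat _ _ f; rewrite Ffh -cmpA e'K cmpm1.
- exact: extended_image_essentially_surjective.
Qed.

End LiftEquivalence.

(** * Ultrafilters and coherent theories *)

Fixpoint satisfies (S : Type) (v : S -> Prop) (p : gform S) : Prop :=
  match p with
  | GAtom a => v a
  | GTrue => True
  | GAnd p q => satisfies v p /\ satisfies v q
  | GOr _ q => exists i, satisfies v (q i)
  end.

Definition is_model (S : Type) (T : gtheory S) (v : S -> Prop) : Prop :=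
  forall p q, T p q -> satisfies v p -> satisfies v q.

Lemma soundness (S : Type) (T : gtheory S) (v : S -> Prop) (p q : gform S) :
  is_model T v -> proves T p q -> satisfies v p -> satisfies v q.
Proof.
move=> vT; elim=> {p q} //=.
- by move=> p q r _ pq _ qr /pq.
- by move=> p q [].
- by move=> p q [].
- by move=> p q r _ pq _ pr vp; split; [exact: pq|exact: pr].
- by move=> I q i vq; exists i.
- by move=> I q r _ qr [i /qr].
- by move=> I p q [vp [i vq]]; exists i.
Qed.

Lemma equivalent_theories_models (S : Type) (T T' : gtheory S) (v : S -> Prop) :
  equivalent_theories T T' -> is_model T v -> is_model T' v.
Proof.
by move=> TT' vT p q pq; apply: (soundness vT); apply/TT'; exact: proves_axiom.
Qed.

(** Otherwise the complements of the finitely many [P i] would all belong to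
    [F], and so would their intersection, which is disjoint from the union. *)
Lemma ultra_finite_exists (X I : Type) (F : set_system X) (P : I -> set X) :
  UltraFilter F -> finite_set [set: I] ->
  F [set x | exists i, P i x] -> exists i, F (P i).
Proof.
move=> FU If FP; apply: contrapT => nP.
have /finite_fsetP[E IE] : finite_set [set: {classic I}] := If.
have FnP : F (\bigcap_(i in [set` E]) ~` P i).
  apply: filter_bigI => i _.
  by have [Fi|//] := in_ultra_setVsetC (P i) FU; case: nP; exists i.
have [x [[i Pix] nPx]] := filter_ex (filterI FP FnP).
by apply: nPx Pix; rewrite -IE.
Qed.

(** An ultrafilter commutes with finite conjunctions and finite disjunctions,
    the only connectives of a coherent formula. *)
Lemma ultralimit_satisfies (S X : Type) (F : set_system X) (v : X -> S -> Prop)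
    (p : gform S) :
  UltraFilter F -> coherent_formula p ->
  satisfies (fun a => F [set x | v x a]) p <-> F [set x | satisfies (v x) p].
Proof.
move=> FU; elim: p => [a _ //|_|p IHp q IHq [/IHp {}IHp /IHq {}IHq]|I q IH] /=.
- by split=> // _; exact: filterT.
- split=> [[/IHp Fp /IHq Fq]|Fpq]; first exact: filterI.
  by split; [apply/IHp|apply/IHq]; apply: filterS Fpq => x [].
- move=> [If qc]; split=> [[i /(IH i (qc i))]|].
    by apply: filterS => x; exists i.
  by move=> /(ultra_finite_exists FU If)[i /(IH i (qc i))]; exists i.
Qed.

(** An axiom [p |- q] of a coherent axiomatization holds at every [v x]; if [p]
    holds at almost all of them then so does [q], and coherent formulas pass to
    and from the ultralimit. *)
Lemma ultralimit_model (S X : Type) (T : gtheory S) (F : set_system X)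
    (v : X -> S -> Prop) :
  UltraFilter F -> is_coherent T -> (forall x, is_model T (v x)) ->
  is_model T (fun a => F [set x | v x a]).
Proof.
move=> FU [T' [T'c TT']] vT.
have T'T : equivalent_theories T' T by move=> p q; split=> /TT'.
apply: (equivalent_theories_models T'T) => p q pq.
have [pc qc] := T'c _ _ pq.
move=> /(ultralimit_satisfies v FU pc) Fp; apply/(ultralimit_satisfies v FU qc).
by apply: filterS Fp => x; exact: equivalent_theories_models pq.
Qed.

(** * Patch topologies *)

Section Patch.
Variables (X : choiceType) (A : set (set X)).

Lemma patch_subbase_open (U : set X) :
  patch_subbase A U -> open (U : set (patch_space A)).
Proof.
move=> AU; exists [set U]; last by rewrite bigcup_set1.
by move=> _ ->; exact: (@finI_from1 _ _ _ id).
Qed.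

Lemma patch_clopen (U : set X) : A U -> clopen (U : set (patch_space A)).
Proof.
move=> AU; split; first by apply: patch_subbase_open; left.
by rewrite -openC; apply: patch_subbase_open; right; rewrite /= setCK.
Qed.

Lemma patch_cvg (F : set_system X) (x : X) : Filter F ->
  (forall U, patch_subbase A U -> U x -> F U) ->
  (F : set_system (patch_space A)) --> (x : patch_space A).
Proof.
move=> FF FA V; rewrite nbhsE => -[U [[D' sD <-] [B D'B Bx]] UV].
apply: filterS UV _; apply: (@filterS _ F _ B); first by move=> y By; exists B.
have [E EA EB] := sD _ D'B; rewrite -EB.
apply: filter_bigI => V' EV'; apply: FA; first exact: set_mem (EA _ EV').
by move: Bx; rewrite -EB; apply.
Qed.

Lemma patch_continuous (Y : topologicalType) (f : Y -> X) :
  (forall U, A U -> clopen (f @^-1` U)) ->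
  continuous (f : Y -> patch_space A).
Proof.
move=> fA y; apply: patch_cvg => U; case=> [AU|/= AU] Uy.
  by apply: open_nbhs_nbhs; split=> //; exact: (fA _ AU).1.
apply: open_nbhs_nbhs; split=> //; rewrite -(setCK U) preimage_setC.
by rewrite openC; exact: (fA _ AU).2.
Qed.

End Patch.

(** If [U] were not a neighbourhood of [x], the neighbourhood filter of [x]
    would have a trace on the complement of [U], and by patch compactness a
    patch cluster point [y] outside [U]. Since the members of [A] are patch
    closed, [y] lies in all those that contain [x], so [x <= y]. *)
Lemma patch_open_upper_open (X : topologicalType) (A : set (set X))
    (U : set (patch_space A)) :
  (forall V : set X, A V -> open V) ->
  (forall x y : X, (forall V, A V -> V x -> V y) -> specialization x y) ->
  compact [set: patch_space A] -> open U ->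
  (forall x y : X, specialization x y -> U x -> U y) -> open (U : set X).
Proof.
move=> Ao Aspec Xc oU uU; rewrite openE => x Ux; apply: contrapT => nUx.
pose F : set_system (patch_space A) := within (~` U) (nbhs (x : X)).
have FF : ProperFilter F.
  apply: Build_ProperFilter_ex => B FB; apply: contrapT => nB.
  have {}FB : nbhs (x : X) [set y | ~ U y -> B y] := FB.
  apply: nUx; apply: filterS FB => y yB; apply: contrapT => nUy.
  by apply: nB; exists y; exact: yB.
have cU : compact (~` U).
  by apply: (subclosed_compact _ Xc) => //; rewrite closedC.
have [|y [nUy Fy]] := cU F FF; first exact: withinT.
apply: nUy; apply: uU Ux; apply: Aspec => V AV Vx.
apply: contrapT => nVy.
have [||z [Vz nVz]] := Fy V (~` V); last exact: nVz.
  apply: (cvg_within (F := nbhs (x : X))).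
  by apply: open_nbhs_nbhs; split=> //; exact: Ao.
apply: open_nbhs_nbhs; split=> //; rewrite openC.
exact: (patch_clopen AV).2.
Qed.

(** * The patch space of points *)

Section PointsPatch.
Variable C : posite.

Lemma basic_openE (c : C) :
  ideal_open (principal c) = [set x : points C | sval x c].
Proof.
apply/seteqP; split=> [x [a ac xa]|x xc]; last first.
  by exists c => //=; exact: Order.POrderTheory.lexx.
exact: (fc_mono (svalP x)) ac xa.
Qed.

Lemma basic_opensP (U : set (points C)) :
  basic_opens U <-> exists c, U = [set x : points C | sval x c].
Proof. by split=> -[c ->]; exists c; rewrite basic_openE. Qed.

Lemma prime_filter_modelP (x : C -> bool) :
  is_model (@prime_filter_theory C) (fun c => x c) <-> is_flat_continuous x.
Proof.
split=> [xT|[xm x0 x2 xc] _ _ [_|a b ab|a b [/= xa xb]|a S aS /= xa]].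
- split.
  + by move=> a b ab; exact: xT _ _ (pf_mono ab).
  + exact: xT _ _ (pf_inhabited C) I.
  + move=> a b xa xb.
    by have [[c [ca cb]] xc] := xT _ _ (pf_filter a b) (conj xa xb); exists c.
  + move=> a S aS xa; have [[b Sb] xb] := xT _ _ (pf_cover aS) xa.
    by exists b.
- exact: x0.
- exact: xm.
- by have [c [ca cb xc']] := x2 _ _ xa xb; exists (exist _ c (conj ca cb)).
- by have [b Sb xb] := xc _ _ aS xa; exists (exist _ b Sb).
Qed.

(** The limit of an ultrafilter of points is its ultralimit as a valuation of
    the atoms; coherence is what makes this valuation a point. *)
Lemma patch_points_compact :
  is_coherent (@prime_filter_theory C) ->
  compact [set: patch_space (basic_opens (C := C))].
Proof.
move=> Tc; rewrite compact_ultra => F FU _.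
pose v c := F [set y : points C | sval y c].
have vT : is_model (@prime_filter_theory C) (fun c => `[< v c >]).
  rewrite (_ : (fun _ => _) = v); last by apply/funext => c; rewrite asboolE.
  apply: ultralimit_model => // y; apply/prime_filter_modelP; exact: svalP y.
pose x : points C := exist _ _ ((prime_filter_modelP _).1 vT).
exists x; split=> //; apply: patch_cvg => U [|/=] /basic_opensP[c Uc].
  by rewrite Uc => /asboolP.
rewrite -(setCK U) Uc => /= nFc.
have [Fc|//] := in_ultra_setVsetC [set y : points C | sval y c] FU.
by case: nFc; exact/asboolP.
Qed.

Hypothesis Csub : subcanonical C.

Lemma basic_open_open (U : set (points C)) : basic_opens U -> open U.
Proof.
by move=> [c ->]; exists (principal c) => //; exact: ideal_principal.
Qed.

Lemma points_specializationP (x y : points C) :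
  specialization x y <-> forall c, sval x c -> sval y c.
Proof.
split=> [xy c xc|xy _ [I iI ->] [a Ia xa]]; last by exists a => //; exact: xy.
apply: (xy [set z : points C | sval z c]) => //.
by apply: basic_open_open; apply/basic_opensP; exists c.
Qed.

Lemma points_specialization_antisym (x y : points C) :
  specialization x y -> specialization y x -> x = y.
Proof.
move=> /points_specializationP xy /points_specializationP yx.
by apply/sig_inj/funext => c; apply/idP/idP; [exact: xy|exact: yx].
Qed.

Lemma open_patch_open (U : set (points C)) :
  open U -> open (U : set (patch_space (basic_opens (C := C)))).
Proof.
move=> [I iI ->].
rewrite (_ : ideal_open I = \bigcup_(c in I) ideal_open (principal c)).
  by apply: bigcup_open => c _; apply: (patch_clopen _).1; exists c.
apply/seteqP; split=> [x [c Ic xc]|x [c Ic]].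
  by exists c => //=; rewrite basic_openE.
by rewrite basic_openE; exists c.
Qed.

(** The topology of the points is recovered from the patch space and its order:
    this is the object part of the isomorphism between [rP . Ap] and [A]. *)
Lemma upper_patch_openP (U : set (points C)) :
  is_coherent (@prime_filter_theory C) ->
  open (U : set (upper_space (Ap_ob C))) <-> open U.
Proof.
move=> Tc; split=> [[oU uU]|oU].
  apply: (patch_open_upper_open (A := basic_opens (C := C))) => //.
  - exact: basic_open_open.
  - move=> x y xy; apply/points_specializationP => c.
    by apply: (xy [set z : points C | sval z c]); apply/basic_opensP; exists c.
  - exact: patch_points_compact.
split; first exact: open_patch_open.
by move=> x y xy; exact: xy.
Qed.

(** If [x] is not below [y], some [c] holds at [x] and not at [y]; its basic
    open is the required clopen upper set. *)
Lemma patch_points_priestley :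
  is_coherent (@prime_filter_theory C) -> priestley_space (Ap_ob C).
Proof.
move=> Tc; split.
- exact: patch_points_compact.
- exact: points_specialization_antisym.
- move=> x y nxy; have [c [xc nyc]] : exists c, sval x c /\ ~ sval y c.
    apply: contrapT => nc; apply/nxy/points_specializationP => c xc.
    by apply: contrapT => nyc; apply: nc; exists c.
  have Bc : basic_opens [set z : points C | sval z c].
    by apply/basic_opensP; exists c.
  exists [set z : points C | sval z c]; split=> //.
    exact: patch_clopen.
  by move=> z t zt; apply: zt; exact: basic_open_open.
Qed.

End PointsPatch.

(** * The functor to preordered spaces *)

Definition continuous_hom (X Y : topologicalType) (f : X -> Y)
    (fc : continuous f) : @hom Top X Y :=
  HB.pack_for (continuousType X Y) f (isContinuous.Build X Y f fc).

Section PatchMap.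
Variables (C D : posite) (f : {f : C -> D | is_site_morphism f}).

Lemma points_map_patch_continuous :
  continuous (points_map f : patch_space (basic_opens (C := D)) ->
                             patch_space (basic_opens (C := C))).
Proof.
apply: patch_continuous => U /basic_opensP[c ->]; apply: patch_clopen.
by apply/basic_opensP; exists (sval f c).
Qed.

Lemma points_map_specialization (x y : points D) :
  specialization x y -> specialization (points_map f x) (points_map f y).
Proof.
move=> xy U oU; apply: (xy (points_map f @^-1` U)).
by move/continuousP: (@points_map_continuous _ _ f); exact.
Qed.

Definition patch_map : @hom PTop (Ap_ob D) (Ap_ob C) :=
  exist (fun g : continuousType (Ap_ob D) (Ap_ob C) => order_preserving g)
    (continuous_hom points_map_patch_continuous) points_map_specialization.

End PatchMap.

Lemma rP_faithful : faithful rP.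
Proof.
move=> X Y f g /continuousEP fg; apply: sig_inj; apply/continuousEP; exact: fg.
Qed.

Theorem mainTheorem1 (K : Type) (site : K -> posite)
  (J_subcanonical : forall k, subcanonical (site k))
  (J_coherent : forall k, is_coherent (prime_filter_theory (C := site k))) :
  let Kop := op_cat (@full_cat Posites K site) in
  let A : functor Kop Top := A_functor site in
  exists Ap_map : forall k l : Kop, hom k l ->
      @hom PTop (Ap_ob (site k)) (Ap_ob (site l)),
    (forall (k l : Kop) (f : hom k l),
       PTop_fun (Ap_map k l f) = Top_fun (fmap A f)) /\
    exists Ap_functorP : @is_functor Kop PTop (fun k => Ap_ob (site k)) Ap_map,
      let Ap : functor Kop PTop := Functor Ap_functorP in
      [/\ naturally_isomorphic (comp_functor rP Ap) A,
          equivalence_with_extended_image A ->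
            equivalence_with_extended_image Ap &
          (forall k, exists M : map_class (site k),
             [/\ reflects_jointly_injective M,
                 forall g : site k -> bool, M _ bool g <-> is_flat_continuous g &
                 has_free_structure M]) ->
            forall k, priestley_space (Ap k)].
Proof.
move=> Kop A.
exists (fun k l f => patch_map f); split=> //.
have ApP : @is_functor Kop PTop (fun k => Ap_ob (site k))
    (fun k l f => patch_map f).
  by split=> [k|k l m f g]; apply: sig_inj; apply/continuousEP => x;
    exact: sig_inj.
exists ApP => Ap.
have rAp : naturally_isomorphic (comp_functor rP Ap) A.
  have tc k : continuous
      (idfun : upper_space (Ap_ob (site k)) -> points (site k)).
    by apply/continuousP => U oU; apply/upper_patch_openP.
  have fc k : continuous
      (idfun : points (site k) -> upper_space (Ap_ob (site k))).
    apply/continuousP => U oU.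
    exact: (upper_patch_openP (J_subcanonical k) _ (J_coherent k)).1 oU.
  exists (fun k => continuous_hom (tc k)); split=> [k|k l f].
    by exists (continuous_hom (fc k)); split; apply/continuousEP.
  by apply/continuousEP.
split=> // [AE|_ k].
  exact: lift_equivalence_with_extended_image rAp rP_faithful AE.
exact: patch_points_priestley.
Qed.
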